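(* For the secret sharing scheme described in the context, in which the secret and the observations of the parties are continuous random variables, the distinguishing security metric $\eta_s$ and the mutual information security metric $\eta_c$ satisfy $$\eta_s\le\sqrt{2\,\eta_c}.$$
   Context: Scheme: the secret $S$ is a continuous real random variable taking values in $[-r,r]$. For a fixed integer $t\ge1$ (maximal number of colluding parties) and $N>t$ parties, party $i\in\{1,\dots,N\}$ receives $Y_i=S+\sum_{j=1}^t\omega_i^j n_j$, where $\omega_i=\exp(2\pi\sqrt{-1}\,i/N)$ and $n_1,\dots,n_t$ are i.i.d. zero-mean circularly symmetric complex Gaussian random variables with variance $\sigma_n^2/t$, independent of $S$. For a set $A=\{i_1,\dots,i_t\}$ of $t$ parties let $Y_A=(Y_{i_1},\dots,Y_{i_t})$ (for $t=1$ this is the observation of a single party). The mutual information security (MIS) metric is $$\eta_c=\max_{A}\ \max_{P_S:\,|S|<r} I(S;Y_A),$$ where $A$ ranges over sets of $t$ parties, $P_S$ over the probability density functions of $S$ with $|S|<r$, and mutual information is measured in bits (logarithm to base 2). The distinguishing security (DS) metric is $$\eta_s=\max_A\ \max_{s_1,s_2\in[-r,r]}D_{\mathrm{TV}}\left(P_{Y_A|S=s_1},P_{Y_A|S=s_2}\right),$$ where $D_{\mathrm{TV}}(P_1,P_2)=\sup_{E}|P_1(E)-P_2(E)|$ is total variation distance. Maxima are understood as suprema. *)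

(* Defs.v *)
From HB Require Import structures.
From mathcomp Require Import all_boot all_order all_algebra.
From mathcomp Require Import complex.
From mathcomp Require Import all_classical all_reals all_analysis.
From mathcomp Require Import measurable_realfun.

Set Implicit Arguments.
Unset Strict Implicit.
Unset Printing Implicit Defensive.

Import Order.TTheory GRing.Theory Num.Theory.
Import numFieldNormedType.Exports.

Local Open Scope classical_set_scope.
Local Open Scope ring_scope.

(* The sigma-algebra on R[i] is the one transported from the product
   sigma-algebra of R * R along z |-> (Re z, Im z), i.e. the Borel one. *)
Section measurable_complex.
Context {R : realType}.

HB.instance Definition _ := isPointed.Build R[i] 0.

Definition complex_pair (z : R[i]) : R * R := (complex.Re z, complex.Im z).

Definition complex_measurable : set (set R[i]) :=
  preimage_set_system setT complex_pair measurable.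

Let complex_measurable_sigma : sigma_algebra setT complex_measurable.
Proof. exact/sigma_algebra_preimage/sigma_algebra_measurable. Qed.

Let complex_measurable0 : complex_measurable set0.
Proof. by case: complex_measurable_sigma. Qed.

Let complex_measurableC A : complex_measurable A -> complex_measurable (~` A).
Proof. by case: complex_measurable_sigma => _ /(_ A) + _; rewrite setTD. Qed.

Let complex_measurable_bigcup (F : (set R[i])^nat) :
  (forall i, complex_measurable (F i)) -> complex_measurable (\bigcup_i F i).
Proof. by case: complex_measurable_sigma => _ _; apply. Qed.

HB.instance Definition _ := @isMeasurable.Build default_measure_display R[i]
  complex_measurable complex_measurable0 complex_measurableC
  complex_measurable_bigcup.

Lemma measurable_fun_complexP d (T : measurableType d) (f : T -> R[i]) :
  measurable_fun setT f <->
  measurable_fun setT (@complex.Re R \o f) /\ measurable_fun setT (@complex.Im R \o f).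
Proof.
rewrite -[X in _ <-> X](measurable_fun_pairP (complex_pair \o f)).
split=> mf _ A mA.
- by rewrite setTI comp_preimage -[X in measurable X]setTI; apply: mf => //;
    exists A => //; rewrite setTI.
- by case: mA => B mB <-; rewrite setTI; exact: mf.
Qed.

Lemma measurable_Re : measurable_fun [set: R[i]] (@complex.Re R).
Proof. by have /measurable_fun_complexP[] := @measurable_id _ R[i] setT. Qed.

Lemma measurable_Im : measurable_fun [set: R[i]] (@complex.Im R).
Proof. by have /measurable_fun_complexP[] := @measurable_id _ R[i] setT. Qed.

Lemma measurable_complexD d (T : measurableType d) (f g : T -> R[i]) :
  measurable_fun setT f -> measurable_fun setT g ->
  measurable_fun setT (fun x => f x + g x).
Proof.
move=> /measurable_fun_complexP[rf jf] /measurable_fun_complexP[rg jg].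
apply/measurable_fun_complexP; split.
- rewrite (_ : _ \o _ = (@complex.Re R \o f) \+ (@complex.Re R \o g)).
    exact: measurable_funD.
  by apply/funext => x /=; case: (f x) (g x) => [? ?] [? ?].
- rewrite (_ : _ \o _ = (@complex.Im R \o f) \+ (@complex.Im R \o g)).
    exact: measurable_funD.
  by apply/funext => x /=; case: (f x) (g x) => [? ?] [? ?].
Qed.

Lemma measurable_complexM d (T : measurableType d) (f g : T -> R[i]) :
  measurable_fun setT f -> measurable_fun setT g ->
  measurable_fun setT (fun x => f x * g x).
Proof.
move=> /measurable_fun_complexP[rf jf] /measurable_fun_complexP[rg jg].
apply/measurable_fun_complexP; split.
- rewrite (_ : _ \o _ = (fun x => (@complex.Re R \o f) x * (@complex.Re R \o g) x -
                                  (@complex.Im R \o f) x * (@complex.Im R \o g) x)).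
    by apply: measurable_funB; exact: measurable_funM.
  by apply/funext => x /=; case: (f x) (g x) => [? ?] [? ?].
- rewrite (_ : _ \o _ = (fun x => (@complex.Re R \o f) x * (@complex.Im R \o g) x +
                                  (@complex.Im R \o f) x * (@complex.Re R \o g) x)).
    by apply: measurable_funD; exact: measurable_funM.
  by apply/funext => x /=; case: (f x) (g x) => [? ?] [? ?].
Qed.

Lemma measurable_complex_sum d (T : measurableType d) n
    (f : 'I_n -> T -> R[i]) :
  (forall i, measurable_fun setT (f i)) ->
  measurable_fun setT (fun x => \sum_(i < n) f i x).
Proof.
elim: n f => [|n IH] f mf.
  by under eq_fun do rewrite big_ord0; exact: measurable_cst.
under eq_fun do rewrite big_ord_recl.
by apply: measurable_complexD => //; exact: IH.
Qed.

Lemma measurable_complex_real d (T : measurableType d) (f : T -> R) :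
  measurable_fun setT f -> measurable_fun setT (fun x => (f x)%:C%C).
Proof.
by move=> mf; apply/measurable_fun_complexP; split => //=; exact: measurable_cst.
Qed.

End measurable_complex.

Section information.
Local Open Scope ereal_scope.
Local Open Scope charge_scope.
Context {R : realType}.

Definition total_variation_dist d (T : measurableType d)
    (P1 P2 : probability T R) : \bar R :=
  ereal_sup [set `|P1 E - P2 E| | E in measurable].

(* Relative entropy in bits.  The negative part of the integrand always has a
   finite integral, so the integral is never of the form +oo - +oo. *)
Definition KL_divergence d (T : measurableType d)
    (P Q : probability T R) : \bar R :=
  if `[< P `<< Q >] then
    \int[P]_x (lne (('d (charge_of_finite_measure P) '/d Q) x) *
               ((ln 2)^-1)%:E)
  else +oo.

Section mutual_information.
Context d d1 d2 {T : measurableType d} {T1 : measurableType d1}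
  {T2 : measurableType d2} (P : probability T R).

Definition RV_pair (X : {RV P >-> T1}) (Y : {RV P >-> T2}) : T -> T1 * T2 :=
  fun x => (X x, Y x).

HB.instance Definition _ (X : {RV P >-> T1}) (Y : {RV P >-> T2}) :=
  @isMeasurableFun.Build _ _ _ _ (RV_pair X Y)
    (measurable_fun_pair (measurable_funPT X) (measurable_funPT Y)).

Definition mutual_information (X : {RV P >-> T1}) (Y : {RV P >-> T2}) :
  \bar R :=
  KL_divergence (distribution P (RV_pair X Y))
                (distribution P X \x distribution P Y).

End mutual_information.

Definition has_pdf (Q : probability (measurableTypeR R) R) (f : R -> R) :=
  [/\ measurable_fun setT f, (forall x, (0 <= f x)%R) &
      forall E : set (measurableTypeR R), measurable E ->
        Q E = \int[lebesgue_measure]_(x in E) (f x)%:E].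

(* Since B i = setT is allowed, this includes the product rule for
   subfamilies. *)
Definition mutually_independent d d' (T : measurableType d)
    (T' : measurableType d') (P : probability T R) (I : finType)
    (X : I -> {RV P >-> T'}) :=
  forall B : I -> set T', (forall i, measurable (B i)) ->
    P (\bigcap_(i in [set: I]) (X i @^-1` B i)) = \prod_(i : I) P (X i @^-1` B i).

(* CN(0, v): real and imaginary parts are independent N(0, v / 2), so that
   E|Z|^2 = v; [normal_prob] takes the standard deviation. *)
Definition circular_gaussian d (T : measurableType d) (P : probability T R)
    (v : R) (Z : {RV P >-> R[i]}) :=
  forall A B : set (measurableTypeR R), measurable A -> measurable B ->
    P [set x | A (complex.Re (Z x)) /\ B (complex.Im (Z x))] =
    normal_prob 0 (Num.sqrt (v / 2)) A * normal_prob 0 (Num.sqrt (v / 2)) B.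

End information.

Section scheme.
Context {R : realType} (N t : nat) {d : measure_display} {T : measurableType d}
  (P : probability T R) (n : 'I_t -> {RV P >-> R[i]}).

(* Party i of {1, ..., N} is (i - 1) : 'I_N. *)
Definition party_root (i : 'I_N) : R[i] :=
  let a := 2 * pi * i.+1%:R / N%:R in (cos a +i* sin a)%C.

Definition share (i : 'I_N) (s : R) (w : T) : R[i] :=
  (s%:C)%C + \sum_(j < t) party_root i ^+ j.+1 * n j w.

(* Observation of the coalition A, as a function of (S, noise). *)
Definition observation (A : {set 'I_N}) (x : measurableTypeR R * T) :
    #|A|.-tuple R[i] :=
  [tuple share (enum_val k) x.1 x.2 | k < #|A|].

Lemma measurable_observation A : measurable_fun setT (observation A).
Proof.
apply/measurable_fun_tnthP => k.
rewrite (_ : _ \o _ = fun x => share (enum_val k) x.1 x.2); last first.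
  by apply/funext => x /=; rewrite tnth_mktuple.
apply: measurable_complexD; first exact: measurable_complex_real.
apply: measurable_complex_sum => j; apply: measurable_complexM.
  exact: measurable_cst.
by apply: measurableT_comp => //; exact: measurable_funPT.
Qed.

HB.instance Definition _ A :=
  @isMeasurableFun.Build _ _ _ _ (observation A) (@measurable_observation A).

Definition observation_at (A : {set 'I_N}) (s : R) (w : T) :
  #|A|.-tuple R[i] := observation A (s, w).

Lemma measurable_observation_at A s : measurable_fun setT (observation_at A s).
Proof.
apply: (measurableT_comp (@measurable_observation A)).
exact: pair1_measurable.
Qed.

HB.instance Definition _ A s :=
  @isMeasurableFun.Build _ _ _ _ (observation_at A s)
    (@measurable_observation_at A s).

HB.instance Definition _ :=
  @isMeasurableFun.Build _ _ (measurableTypeR R * T)%type (measurableTypeR R)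
    fst measurable_fst.

Section secret.
Variable Q : probability (measurableTypeR R) R.

(* A secret S of law Q independent of the noise is realized as the first
   coordinate of R * T under the product probability. *)
Definition secret_noise_prob : probability (measurableTypeR R * T)%type R :=
  (Q \x P)%E.

Definition secret : {RV secret_noise_prob >-> measurableTypeR R} :=
  [the {mfun _ >-> _} of @fst (measurableTypeR R) T].

Definition observationRV (A : {set 'I_N}) :
  {RV secret_noise_prob >-> #|A|.-tuple R[i]} :=
  [the {mfun _ >-> _} of observation A].

End secret.

(* P_{Y_A | S = s}: the version of the conditional law given by substituting
   S = s, legitimate by independence of S and the noise; it does not depend on
   the law of S (see observation_condE). *)
Definition observation_cond (A : {set 'I_N}) (s : R) :
  probability (#|A|.-tuple R[i]) R := distribution P (observation_at A s).

Lemma observation_condE (Q : probability (measurableTypeR R) R) A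
    (B : set (measurableTypeR R)) E : measurable B -> measurable E ->
  (secret_noise_prob Q (secret Q @^-1` B `&` observationRV Q A @^-1` E) =
   \int[Q]_(s in B) observation_cond A s E)%E.
Proof.
move=> mB mE; rewrite /secret_noise_prob /product_measure1.
rewrite [RHS]integral_mkcond; apply: eq_integral => s _ /=.
rewrite /patch /observation_cond /distribution /pushforward /xsection.
case: ifPn => [/set_mem Bs|/negP Bs].
  by congr (P _); apply/seteqP; split => w /=; rewrite inE => /=; [case|split].
rewrite (_ : [set _ | _] = set0) ?measure0//.
by apply/seteqP; split => w //=; rewrite inE => -[/mem_set].
Qed.

Definition admissible_prior (r : R) : set (probability (measurableTypeR R) R) :=
  [set Q | (exists f, has_pdf Q f) /\ Q [set s | `|s| < r] = 1%E].

Definition MIS (r : R) : \bar R :=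
  ereal_sup [set I | exists (A : {set 'I_N})
                            (Q : probability (measurableTypeR R) R),
    [/\ #|A| = t, admissible_prior r Q &
        I = mutual_information (secret Q) (observationRV Q A)]].

Definition DS (r : R) : \bar R :=
  ereal_sup [set D | exists (A : {set 'I_N}) (s1 s2 : R),
    [/\ #|A| = t, - r <= s1 <= r, - r <= s2 <= r &
        D = total_variation_dist (observation_cond A s1)
                                 (observation_cond A s2)]].

End scheme.

(* Main.v *)
(* Write C = sqrt (2 MIS).  Testing the density of the joint law of (S, Y_A)
   against exponentials of bounded functions gives a weak Pinsker inequality:
   if |phi|, |psi| <= 1 and E phi(S) = 0, then
   (E phi(S) psi(Y_A))^2 <= 2 I(S; Y_A).  The constant is not optimal; it
   suffices because mutual information is in bits and ln 2 <= 3/4.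

   A point mass is not an admissible prior, so take for S an equal mixture of
   the uniform laws on two short intervals near s1 and s2, with phi = 1 on the
   first and -1 on the second.  For a test function 0 <= f <= 1 which is
   Lipschitz in the secret, shrinking the intervals yields
   |E (f | S = s1) - E (f | S = s2)| <= C.  Finally, every measurable set is
   an L^1 limit of such f simultaneously for both conditional laws: the sets
   with this property form a sigma-algebra, which contains the half-spaces
   since the secret only translates the observations. *)
From HB Require Import structures.
Require Import Defs.
From mathcomp Require Import all_boot all_order all_algebra.
From mathcomp Require Import complex.
From mathcomp Require Import all_classical all_reals all_analysis.
From mathcomp Require Import measurable_realfun ring lra.

Set Implicit Arguments.
Unset Strict Implicit.
Unset Printing Implicit Defensive.

Import Order.TTheory GRing.Theory Num.Theory.
Import numFieldNormedType.Exports.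

Local Open Scope classical_set_scope.
Local Open Scope ring_scope.

(** * Numerical bounds on the exponential and on [ln 2] *)

Section exponential.
Context {R : realType}.
Implicit Types x : R.

(** From the quadratic term on, consecutive terms of the exponential series have ratio at most
    [(3 / 4) / 3 = 1 / 4] in absolute value. The tail is thus dominated by a geometric series with
    first term [x ^+ 2 / 2], whose sum is [2 / 3 * x ^+ 2]. *)
Lemma expR_le_quadratic x : `|x| <= 3 / 4 -> expR x <= 1 + x + 2 / 3 * x ^+ 2.
Proof.
move=> x34.
have coefE n : exp_coeff x n.+2 <= x ^+ 2 / 2 * (1 / 4) ^+ n.
  rewrite /exp_coeff /= (le_trans (ler_norm _))//.
  elim: n => [|n IH].
    by rewrite expr0 mulr1 normrM normrX (ger0_norm (x:=2^-1)) ?real_normK ?num_real.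
  have -> : x ^+ n.+3 / n.+3`!%:R = x ^+ n.+2 / n.+2`!%:R * (x / n.+3%:R).
    by rewrite exprSr factS mulnC natrM invfM mulrACA.
  rewrite normrM (exprSr (1 / 4)) [leRHS]mulrA ler_pM// normrM normfV normr_nat.
  rewrite (le_trans (ler_wpM2r _ x34))// ler_pdivrMr//.
  have : 3 <= n.+3%:R :> R by rewrite ler_nat.
  lra.
(* Keeping the geometric remainder in the bound makes the induction close: from [n] to [n.+1] the
   remainder decreases by exactly [x ^+ 2 / 2 * (1 / 4) ^+ n]. *)
have sumE n : series (exp_coeff x) n.+2 <=
    1 + x + 2 / 3 * x ^+ 2 - 2 / 3 * x ^+ 2 * (1 / 4) ^+ n.
  elim: n => [|n IH].
    rewrite /series/= !big_nat_recr//= big_geq// /exp_coeff/= expr0 expr1.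
    by rewrite fact0 invr1; lra.
  rewrite seriesSr (le_trans (lerD IH (coefE n)))// (exprS (1 / 4)).
  set a := _ ^+ n; lra.
rewrite /expR; apply: limr_le; first exact: is_cvg_series_exp_coeff.
near=> n.
have -> : n = n.-2.+2 by rewrite -subn2 -addn2 subnK//; near: n; exists 2%N.
rewrite (le_trans (sumE _))// gerBl// mulr_ge0// ?exprn_ge0// mulr_ge0 ?sqr_ge0//.
Unshelve. all: by end_near. Qed.

(** Since [1 + 1 / 8 <= expR (1 / 8)], the sixth power gives [2 <= (9 / 8) ^+ 6 <= expR (3 / 4)]. *)
Lemma ln2_le34 : ln 2 <= 3 / 4 :> R.
Proof.
rewrite -[leRHS]expRK ler_ln ?posrE ?expR_gt0//.
have -> : 3 / 4 = 6%:R * (1 / 8) :> R by lra.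
rewrite expRM_natl.
have h0 : 0 <= 1 + 1 / 8 :> R by lra.
by apply: le_trans (lerXn2r 6 h0 _ (expR_ge1Dx _)); rewrite ?nnegrE ?expR_ge0//; lra.
Qed.

End exponential.

(** * Lower bounds on relative entropy by bounded test functions *)

Section relative_entropy.
Context {R : realType} d (T : measurableType d).
Implicit Types (P Q : probability T R) (f g h : T -> R).

Lemma bounded_integrable P (M : R) h : measurable_fun setT h ->
  (forall x, `|h x| <= M) -> P.-integrable setT (EFin \o h).
Proof.
move=> mh hM; apply: measurable_bounded_integrable => //.
  by rewrite (le_lt_trans (probability_le1 _ _))// ltry.
by exists M; split; [exact: num_real|move=> N /ltW MN x _; exact: le_trans MN].
Qed.

Lemma Rintegral_probability_cst P (c : R) : \int[P]_x c = c.
Proof. by rewrite Rintegral_cst//= probability_setT mulr1. Qed.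

Lemma ler_Rintegral_probability P (M : R) f g :
    measurable_fun setT f -> measurable_fun setT g ->
    (forall x, `|f x| <= M) -> (forall x, `|g x| <= M) ->
  (forall x, f x <= g x) -> \int[P]_x f x <= \int[P]_x g x.
Proof.
move=> mf mg fM gM fg.
by apply: le_Rintegral => //; [exact: bounded_integrable fM|exact: bounded_integrable gM].
Qed.

Lemma normr_Rintegral_probability P (M : R) f : measurable_fun setT f ->
  (forall x, `|f x| <= M) -> `|\int[P]_x f x| <= M.
Proof.
move=> mf fM; rewrite (le_trans (le_normr_Rintegral _ _))//.
  exact: bounded_integrable fM.
rewrite -[leRHS](Rintegral_probability_cst P).
apply: (@ler_Rintegral_probability _ `|M|) => //.
- exact: measurableT_comp.
- by move=> x; rewrite normr_id (le_trans (fM x))// ler_norm.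
Qed.

(* The inequality [ln x >= h + 1 - expR h / x], integrated against [P] at the
   density [x] of [P] with respect to [Q]; the last term then integrates to at
   most the [Q]-expectation of [expR h]. *)
Lemma KL_divergence_ge P Q (M : R) h : measurable_fun setT h ->
  (forall x, `|h x| <= M) ->
  (((\int[P]_x h x + 1 - \int[Q]_x expR (h x)) / ln 2)%:E <= KL_divergence P Q)%E.
Proof.
move=> mh hM; rewrite /KL_divergence; case: asboolP => [PQ|_]; last exact: leey.
set rho := Radon_Nikodym _ _.
have rhoint : Q.-integrable setT rho by exact: Radon_Nikodym_integrable.
have rhofin x : rho x \is a fin_num by exact: Radon_Nikodym_fin_num.
pose q := fine \o rho.
have rhoE x : rho x = (q x)%:E by rewrite fineK.
have mq : measurable_fun setT q.
  by apply: measurableT_comp => //; exact: measurable_int rhoint.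
(* This is the quotient [expR (h x) / q x], set to 0 where the density is not positive. There
   [w x * q x] vanishes too, so [w * q <= expR h] holds at every point. *)
pose w x := if 0 < q x then expR (h x - ln (q x)) else 0.
have mexp : measurable_fun setT (fun x => expR (h x)) by exact: measurableT_comp.
have mD : measurable_fun setT (fun x => 0 < q x).
  exact: measurable_fun_ltr.
have mw : measurable_fun setT w.
  apply: measurable_fun_ifT => //; apply: measurableT_comp => //.
  by apply: measurable_funB => //; exact: measurableT_comp.
have w0 x : 0 <= w x.
  by rewrite /w; case: ifPn => // q0; rewrite expR_ge0.
have expM x : `|expR (h x)| <= expR M.
  by rewrite ger0_norm ?expR_ge0// ler_expR (le_trans (ler_norm _)).
have intexp : Q.-integrable setT (EFin \o (fun x => expR (h x))).
  exact: bounded_integrable expM.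
have wle : (\int[P]_x (w x)%:E <= \int[Q]_x (expR (h x))%:E)%E.
  (* The change of variables produces the sigma-finite version of the density, which agrees with
     [rho] only [Q]-almost everywhere. *)
  rewrite -(Radon_Nikodym_SigmaFinite.change_of_variables PQ)//; last first.
    exact/measurable_EFinP.
  rewrite (ae_eq_integral (fun x => (w x)%:E * rho x)%E)//; last 3 first.
  - apply: emeasurable_funM; first exact/measurable_EFinP.
    exact: measurable_int (Radon_Nikodym_SigmaFinite.f_integrable PQ).
  - apply: emeasurable_funM; first exact/measurable_EFinP.
    exact: measurable_int rhoint.
  - apply: ae_eqe_mul2l; exact: ae_eq_Radon_Nikodym_SigmaFinite.
  under eq_integral do rewrite rhoE -EFinM.
  have wq x : 0 <= w x * q x <= expR (h x).
    rewrite /w; case: ifPn => q0; last by rewrite mul0r lexx expR_ge0.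
    by rewrite expRB lnK ?posrE// divfK ?gt_eqF// lexx expR_ge0.
  apply: ge0_le_integral => //.
  - by move=> x _; rewrite lee_fin; have /andP[] := wq x.
  - by apply/measurable_EFinP/measurable_funM.
  - exact/measurable_EFinP.
  - by move=> x _; rewrite lee_fin; have /andP[] := wq x.
have intw : P.-integrable setT (EFin \o w).
  apply/integrableP; split; first exact/measurable_EFinP.
  under eq_integral do rewrite /= ger0_norm//.
  apply: le_lt_trans wle _; rewrite ltey_eq.
  by rewrite (integrable_fin_num _ intexp).
have inth : P.-integrable setT (EFin \o h) by exact: bounded_integrable hM.
pose L x := (h x + 1 - w x) / ln 2.
have int1 : P.-integrable setT (EFin \o (fun x => h x + 1)).
  apply: (@bounded_integrable _ (M + 1)); first exact: measurable_funD.
  by move=> x; rewrite (le_trans (ler_normD _ _))// normr1 lerD2r.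
have intL0 : P.-integrable setT (EFin \o (fun x => h x + 1 - w x)).
  exact: (integrableB measurableT int1 intw).
have ln2V_ge0 : 0 <= (ln 2)^-1 :> R by rewrite invr_ge0 ln_ge0// ler1n.
have LE : (((\int[P]_x h x + 1 - \int[Q]_x expR (h x)) / ln 2)%:E <=
    \int[P]_x (L x)%:E)%E.
  rewrite -[leRHS]fineK; last first.
    apply: integrable_fin_num => //.
    under eq_fun do rewrite /L EFinM.
    exact: integrableZr.
  rewrite lee_fin -/(Rintegral P setT L) /L RintegralZr// ler_wpM2r//.
  rewrite RintegralB// RintegralD//; last exact: finite_measure_integrable_cst.
  rewrite Rintegral_probability_cst lerD2l lerN2.
  by rewrite fine_le ?integrable_fin_num.
apply: le_trans LE _.
have mlne : measurable_fun setT (fun x => lne (rho x) * ((ln 2)^-1)%:E)%E.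
  apply: emeasurable_funM => //.
  rewrite (_ : (fun _ => _) = (fun x => if 0 < q x then (ln (q x))%:E else -oo%E)).
    apply: measurable_fun_ifT => //; apply/measurable_EFinP.
    exact: measurableT_comp.
  by apply/funext => x; rewrite rhoE /= ltNge; case: (_ <= _).
(* The pointwise comparison is available only where [q] is positive. The exceptional set is
   [P]-null, because its [P]-measure is the integral over it of a nonpositive density. *)
pose N := [set x | q x <= 0].
have mN : measurable N.
  rewrite (_ : N = q @^-1` [set` `]-oo, 0]]).
    by rewrite -[X in measurable X]setTI; exact: mq.
  by apply/seteqP; split=> x /=; rewrite in_itv.
have PN0 : P N = 0%E.
  apply/eqP; rewrite eq_le measure_ge0 andbT.
  have -> : P N = (\int[Q]_(x in N) rho x)%E.
    exact: (@Radon_Nikodym_integral _ _ _ (charge_of_finite_measure P) Q _ PQ mN).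
  rewrite -(integral0 Q N); apply: le_integral => //.
  - exact: integrableS rhoint.
  - exact: integrable0.
  - by move=> x /set_mem; rewrite rhoE lee_fin.
have lelne x : 0 < q x -> ((L x)%:E <= lne (rho x) * ((ln 2)^-1)%:E)%E.
  move=> q0; rewrite rhoE lne_EFin// -EFinM lee_fin ler_wpM2r//.
  rewrite /w q0.
  have := expR_ge1Dx (h x - ln (q x)); lra.
have aele : {ae P, forall x, (L x)%:E <= lne (rho x) * ((ln 2)^-1)%:E}%E.
  exists N; split => // x /= nle; rewrite /N /= leNgt.
  by apply/negP => q0; exact/nle/lelne.
have mL : measurable_fun setT (EFin \o L).
  apply/measurable_EFinP; apply: measurable_funM => //.
  apply: measurable_funB => //; exact: measurable_funD.
(* The logarithm of the density need not be integrable, so positive and negative parts are compared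
   separately in the extended reals. *)
rewrite integralE [leRHS]integralE; apply: leeB.
- apply: ae_ge0_le_integral => //; try exact: measurable_funepos.
  apply: filterS aele => x le _; rewrite !funeposE.
  by rewrite ge_max le_max le le_max lexx orbT.
- apply: ae_ge0_le_integral => //; try exact: measurable_funeneg.
  apply: filterS aele => x le _; rewrite !funenegE.
  by rewrite ge_max le_max leeN2 le le_max lexx orbT.
Qed.

(** The exponential bound is applied to [h = 3 / 4 * D * g], where the factor 3/4 keeps [h] in the
    range of the quadratic estimate. Under [Q] the linear term vanishes, so the expectation of
    [expR h] is at most [1 + 3 / 8 * D ^+ 2], while under [P] the mean of [h] is [3 / 4 * D ^+ 2].
    The gain [3 / 8 * D ^+ 2], divided by [ln 2 <= 3 / 4], is at least [D ^+ 2 / 2]. *)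
Lemma sqr_Rintegral_le_KL_divergence P Q g : measurable_fun setT g ->
  (forall x, `|g x| <= 1) -> \int[Q]_x g x = 0 ->
  (((\int[P]_x g x) ^+ 2)%:E <= 2%:E * KL_divergence P Q)%E.
Proof.
move=> mg g1 Qg0; set D := \int[P]_x g x.
have D1 : `|D| <= 1 by exact: normr_Rintegral_probability.
pose h x := 3 / 4 * D * g x.
have mh : measurable_fun setT h by exact: measurable_funM.
have h34 x : `|h x| <= 3 / 4.
  by rewrite /h -mulrA normrM ger0_norm// ler_piMr// normrM mulr_ile1.
have := KL_divergence_ge P Q mh h34.
have intg (P' : probability T R) : P'.-integrable setT (EFin \o g).
  exact: bounded_integrable g1.
rewrite {1}/h RintegralZl ?intg// -/D.
have expD : \int[Q]_x expR (h x) <= 1 + 3 / 8 * D ^+ 2.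
  pose B x := 1 + 3 / 8 * D ^+ 2 + 3 / 4 * D * g x.
  have intZ : Q.-integrable setT (EFin \o (fun x => 3 / 4 * D * g x)).
    exact: bounded_integrable h34.
  apply: (@le_trans _ _ (\int[Q]_x B x)); last first.
    rewrite RintegralD//; last exact: finite_measure_integrable_cst.
    by rewrite Rintegral_probability_cst RintegralZl ?intg// Qg0 mulr0 addr0.
  apply: le_Rintegral => //.
  - apply: (@bounded_integrable _ (expR (3 / 4))); first exact: measurableT_comp.
    move=> x; rewrite ger0_norm ?expR_ge0// ler_expR.
    exact: le_trans (ler_norm _) _.
  - apply: (@bounded_integrable _ (1 + 3 / 8 * D ^+ 2 + 3 / 4)).
      by apply: measurable_funD.
    move=> x; rewrite (le_trans (ler_normD _ _))// lerD//; last exact: h34.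
    by rewrite ger0_norm// addr_ge0// mulr_ge0// sqr_ge0.
  - move=> x _; apply: (le_trans (expR_le_quadratic (h34 x))).
    have g2 : g x ^+ 2 <= 1 by rewrite -real_normK ?num_real// exprn_ile1.
    have : D ^+ 2 * g x ^+ 2 <= D ^+ 2 by rewrite ler_piMr// sqr_ge0.
    rewrite /B /h !exprMn; lra.
have ln2_gt0 : 0 < ln 2 :> R by rewrite ln_gt0// ltr1n.
move=> KL; apply: (@le_trans _ _ (2%:E * (D ^+ 2 / 2)%:E)%E).
  by rewrite -EFinM lee_fin mulrC divfK.
rewrite lee_pmul2l//; apply: le_trans KL; rewrite lee_fin ler_pdivlMr//.
apply: (@le_trans _ _ (D ^+ 2 / 2 * (3 / 4))).
  by rewrite ler_wpM2l ?ln2_le34// mulr_ge0// sqr_ge0.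
rewrite expr2 in expD *; lra.
Qed.

End relative_entropy.

(** * Correlation of bounded functions versus mutual information *)

Section mutual_information_bound.
Context {R : realType} d d1 d2 (T : measurableType d) (T1 : measurableType d1)
  (T2 : measurableType d2) (P : probability T R).
Variables (X : {RV P >-> T1}) (Y : {RV P >-> T2}) (phi : T1 -> R) (psi : T2 -> R).
Hypotheses (mphi : measurable_fun setT phi) (mpsi : measurable_fun setT psi).
Hypotheses (phi1 : forall x, `|phi x| <= 1) (psi1 : forall y, `|psi y| <= 1).

(** The test function is the product of [phi] and [psi] on the two coordinates. Under the product of
    the marginals its integral factors by Fubini, and the factor of [phi] is zero, so the relative
    entropy bound applies. *)
Lemma sqr_Rintegral_le_mutual_information : \int[P]_x phi (X x) = 0 ->
  (((\int[P]_x (phi (X x) * psi (Y x))) ^+ 2)%:E <= 2%:E * mutual_information X Y)%E.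
Proof.
move=> phi0; pose g (z : T1 * T2) := phi z.1 * psi z.2.
have mg : measurable_fun setT g.
  by apply: measurable_funM; exact: measurableT_comp.
have g1 z : `|g z| <= 1 by rewrite normrM mulr_ile1.
have mX : measurable_fun setT X by exact: measurable_funPT.
have mY : measurable_fun setT Y by exact: measurable_funPT.
have pE : \int[P]_x (phi (X x) * psi (Y x)) = \int[distribution P (RV_pair X Y)]_z g z.
  rewrite /Rintegral integral_distribution//; first exact/measurable_EFinP.
  apply: (@bounded_integrable _ _ _ _ 1) => //.
  by apply: measurable_funM; exact: measurableT_comp.
rewrite pE; apply: sqr_Rintegral_le_KL_divergence => //.
have int_g : (distribution P X \x distribution P Y)%E.-integrable setT (EFin \o g).
  exact: (@bounded_integrable _ _ _ _ 1).
rewrite /Rintegral -integral12_prod_meas1//.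
pose c := \int[distribution P Y]_y psi y.
have intpsi : (distribution P Y).-integrable setT (EFin \o psi).
  exact: (@bounded_integrable _ _ _ _ 1).
have intphi : (distribution P X).-integrable setT (EFin \o phi).
  exact: (@bounded_integrable _ _ _ _ 1).
have phi0' : \int[distribution P X]_x phi x = 0.
  rewrite -phi0 /Rintegral integral_distribution//; first exact/measurable_EFinP.
  by apply: (@bounded_integrable _ _ _ _ 1) => //; exact: measurableT_comp.
under eq_integral => x _.
  rewrite /fubini_F /g /=; under eq_integral do rewrite EFinM.
  rewrite integralZl// -[X in (_ * X)%E]fineK; last exact: integrable_fin_num.
  over.
rewrite /= integralZr// fineM//; last exact: integrable_fin_num.
by rewrite -[RHS](mul0r c); congr *%R.
Qed.

End mutual_information_bound.

(** * Equal mixture of two probabilities *)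

Section half_mixture.
Context {R : realType} d (T : measurableType d) (P1 P2 : probability T R).

Definition half_mixture : set T -> \bar R :=
  mscale (2^-1)%:nng (measure_add P1 P2).

HB.instance Definition _ := Measure.on half_mixture.

Lemma half_mixtureE A : half_mixture A = ((2^-1)%:E * (P1 A + P2 A))%E.
Proof. by congr (_ * _)%E; exact: measure_addE. Qed.

Let half_mixture_setT : half_mixture setT = 1%E.
Proof.
by rewrite half_mixtureE !probability_setT -EFinD -EFinM mulVf// -natrD pnatr_eq0.
Qed.

HB.instance Definition _ := @Measure_isProbability.Build _ _ R
  half_mixture half_mixture_setT.

Lemma Rintegral_half_mixture (M : R) (f : T -> R) : measurable_fun setT f ->
  (forall x, `|f x| <= M) ->
  \int[half_mixture]_x f x = (\int[P1]_x f x + \int[P2]_x f x) / 2.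
Proof.
(* Adding the bound [M] makes the integrand nonnegative, as the formulas for scaled and added
   measures require; the constant cancels at the end. *)
move=> mf fM; pose g x := f x + M.
have mg : measurable_fun setT g by exact: measurable_funD.
have g0 x : 0 <= g x by have := fM x; rewrite ler_norml /g => /andP[]; lra.
have intf (P : probability T R) : P.-integrable setT (EFin \o f) by exact: bounded_integrable fM.
have intg (P : probability T R) : P.-integrable setT (EFin \o g).
  apply: (@bounded_integrable _ _ _ _ (M + M)) => // x.
  by rewrite ger0_norm// lerD2r (le_trans (ler_norm _)).
have fine_half : 0 <= 2^-1 :> R by lra.
have fing (P : probability T R) : (\int[P]_x (g x)%:E)%E \is a fin_num.
  exact: integrable_fin_num (intg P).
have gE (P : probability T R) : \int[P]_x g x = \int[P]_x f x + M.
  rewrite RintegralD//; [|exact: intf|exact: finite_measure_integrable_cst].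
  by rewrite Rintegral_probability_cst.
have : \int[half_mixture]_x g x = 2^-1 * (\int[P1]_x g x + \int[P2]_x g x).
  rewrite /Rintegral ge0_integral_mscale//; last 2 first.
  - exact/measurable_EFinP.
  - by move=> x _; rewrite lee_fin.
  rewrite ge0_integral_measure_add//; last 2 first.
  - by move=> x _; rewrite lee_fin.
  - exact/measurable_EFinP.
  rewrite fineM//; last by rewrite fin_numD !fing.
  by rewrite fineD ?fing.
rewrite !gE; lra.
Qed.

End half_mixture.

(** * Sets whose indicators are limits in mean of a class of test functions *)

Section L1_approximation.
Context {R : realType} d (S : measurableType d) (mu : probability S R).
Implicit Types (A B : set S) (f g : S -> R).

Definition L1_approximable (G : set (S -> R)) : set (set S) :=
  [set A | measurable A /\
    forall e, 0 < e -> exists2 f, G f & \int[mu]_x `|f x - \1_A x| <= e].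

(** This is continuity of [mu] from below, written with integrals of indicators. *)
Lemma nondecreasing_bigcup_approx (F : (set S)^nat) (e : R) :
  (forall n, measurable (F n)) -> nondecreasing_seq F -> 0 < e ->
  exists n, \int[mu]_x (\1_(\bigcup_k F k) x - \1_(F n) x) <= e.
Proof.
move=> mF ndF e0; have mU := bigcupT_measurable F mF.
have intE A : measurable A -> \int[mu]_x \1_A x = fine (mu A).
  by move=> mA; rewrite /Rintegral integral_indic// setIT.
have : fine (mu (F n)) @[n --> \oo] --> fine (mu (\bigcup_k F k)).
  apply: fine_cvg; rewrite fineK ?fin_num_measure//.
  exact: nondecreasing_cvg_mu.
move=> /cvgrPdist_le/(_ e e0)[n _ /(_ n (leqnn n))/= dist].
exists n; rewrite RintegralB//; last 2 first.
- exact: integrable_indic.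
- exact: integrable_indic.
by rewrite !intE// (le_trans (ler_norm _)).
Qed.

Variable G : set (S -> R).
Hypotheses (mG : forall f, G f -> measurable_fun setT f)
  (G01 : forall f x, G f -> 0 <= f x <= 1)
  (G0 : G (cst 0))
  (GC : forall f, G f -> G (fun x => 1 - f x))
  (GM : forall f g, G f -> G g -> G (fun x => f x * g x)).

Let err f A x := `|f x - \1_A x|.

Let err1 f A x : G f -> `|err f A x| <= 1.
Proof.
move=> Gf; have /andP[f0 f1] := G01 x Gf; rewrite /err normr_id indicE ler_norml.
by case: (x \in A) => /=; lra.
Qed.

Let merr f A : G f -> measurable A -> measurable_fun setT (err f A).
Proof.
move=> Gf mA; apply: measurableT_comp => //; apply: measurable_funB.
  exact: mG.
exact: measurable_indic.
Qed.

Let int_err f A : G f -> measurable A -> mu.-integrable setT (EFin \o err f A).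
Proof.
by move=> Gf mA; apply: (@bounded_integrable _ _ _ _ 1);
  [exact: merr|move=> x; exact: err1].
Qed.

Let L1_approximableC A : L1_approximable G A -> L1_approximable G (~` A).
Proof.
move=> [mA GA]; split; first exact: measurableC.
move=> e /GA[f Gf fe]; exists (fun x => 1 - f x); first exact: GC.
apply: le_trans fe; rewrite le_eqVlt; apply/orP; left; apply/eqP.
apply: eq_Rintegral => x _; rewrite !indicE in_setC -normrN.
by congr `|_|; case: (x \in A) => /=; lra.
Qed.

Let L1_approximableU A B :
  L1_approximable G A -> L1_approximable G B -> L1_approximable G (A `|` B).
Proof.
move=> [mA GA] [mB GB]; split; first exact: measurableU.
move=> e e0; have e20 : 0 < e / 2 by rewrite divr_gt0.
have [f Gf fe] := GA _ e20; have [g Gg ge] := GB _ e20.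
(* By De Morgan this test plays the role of the indicator of the union; since all values lie in
   [0, 1], its pointwise error is at most the sum of the two errors. *)
have Gh : G (fun x => 1 - (1 - f x) * (1 - g x)) by apply/GC/GM; exact: GC.
exists (fun x => 1 - (1 - f x) * (1 - g x)) => //.
rewrite (splitr e); apply: le_trans (lerD fe ge).
rewrite -RintegralD//; [|exact: int_err|exact: int_err].
apply: (@ler_Rintegral_probability _ _ _ _ 2).
- by apply: (merr Gh); exact: measurableU.
- by apply: measurable_funD; exact: merr.
- by move=> x; rewrite (le_trans (err1 _ _ Gh))// ler1n.
- move=> x; rewrite (le_trans (ler_normD _ _))// -[leRHS](@natrD _ 1 1).
  by rewrite lerD//; exact: err1.
move=> x; have /andP[f0 f1] := G01 x Gf; have /andP[g0 g1] := G01 x Gg.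
rewrite !indicE in_setU; case: (x \in A); case: (x \in B) => /=;
  rewrite ?subr0 ?(ler0_norm (x := f x - 1)) ?(ler0_norm (x := g x - 1))
    ?(ger0_norm f0) ?(ger0_norm g0); try lra;
  rewrite ler_norml; nra.
Qed.

(** Complements and finite unions are inherited from the closure of [G] under [1 - f] and products.
    A countable union is first replaced by a finite partial union, by continuity from below, and
    that one is then approximated, each at a cost of [e / 2]. *)
Lemma sigma_algebra_L1_approximable : sigma_algebra setT (L1_approximable G).
Proof.
have L0 : L1_approximable G set0.
  split=> // e e0; exists (cst 0) => //.
  under eq_Rintegral do rewrite indic0 subr0 normr0.
  by rewrite Rintegral_probability_cst ltW.
split => //; first by move=> A GA; rewrite setTD; exact: L1_approximableC.
move=> F GF; pose B n := \big[setU/set0]_(i < n.+1) F i.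
have GB n : L1_approximable G (B n).
  by apply: big_ind => //; exact: L1_approximableU.
have mB n : measurable (B n) by have [] := GB n.
rewrite -bigcup_bigsetU_bigcup -/B.
split; first exact: bigcupT_measurable.
move=> e e0; have e20 : 0 < e / 2 by rewrite divr_gt0.
have ndB : nondecreasing_seq B.
  by move=> m n mn; apply/subsetPset/subset_bigsetU.
have [n Bn] := nondecreasing_bigcup_approx mB ndB e20.
have [_ /(_ _ e20)[f Gf fe]] := GB n; exists f => //.
have mU : measurable (\bigcup_k B k) by exact: bigcupT_measurable.
have mI : measurable_fun setT (fun x : S => \1_(\bigcup_k B k) x - \1_(B n) x : R).
  by apply: measurable_funB; exact: measurable_indic.
have I1 x : `|\1_(\bigcup_k B k) x - \1_(B n) x : R| <= 1.
  rewrite !indicE ler_norml; case: (_ \in _); case: (_ \in _) => /=; lra.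
rewrite (splitr e); apply: le_trans (lerD fe Bn).
rewrite -RintegralD//; [|exact: int_err|exact: bounded_integrable I1].
apply: (@ler_Rintegral_probability _ _ _ _ 2).
- exact: merr.
- by apply: measurable_funD => //; exact: merr.
- by move=> x; rewrite (le_trans (err1 _ _ Gf))// ler1n.
- move=> x; rewrite (le_trans (ler_normD _ _))// -[leRHS](@natrD _ 1 1).
  by rewrite lerD//; exact: err1.
move=> x; rewrite -(subrKA (\1_(B n) x)) (le_trans (ler_normD _ _))// lerD2l.
rewrite distrC ger0_norm// subr_ge0 !indicE ler_nat.
by have [/set_mem Bx|//] := boolP (x \in B n); rewrite mem_set//; exists n.
Qed.

End L1_approximation.

(** * Averages over short intervals *)

Section uniform_integral.
Context {R : realType} (a b : R) (ab : a < b).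
Local Notation U := (uniform_prob ab).

Lemma eq_Rintegral_uniform_prob (f g : R -> R) :
  measurable_fun setT f -> measurable_fun setT g ->
  {in `[a, b], f =1 g} -> \int[U]_x f x = \int[U]_x g x.
Proof.
move=> mf mg fg; congr fine; apply: ae_eq_integral => //.
- exact/measurable_EFinP.
- exact/measurable_EFinP.
exists (~` `[a, b]%classic); split.
- exact: measurableC.
- rewrite /= /uniform_prob integral_uniform_pdf setICl.
  exact: integral_set0.
- by move=> x /= nfg ab_x; apply: nfg => _; rewrite fg.
Qed.

Lemma Rintegral_uniform_prob_dist (M c e : R) (f : R -> R) :
  measurable_fun setT f -> (forall x, `|f x| <= M) -> 0 <= e ->
  {in `[a, b], forall x, `|f x - c| <= e} -> `|\int[U]_x f x - c| <= e.
Proof.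
(* Truncating to 0 off the interval turns a bound on the support into a bound at every point,
   without changing the integral. *)
move=> mf fM e0 fc; pose g x := if x \in `[a, b] then f x - c else 0.
have mg : measurable_fun setT g.
  apply: measurable_fun_ifT => //; last exact: measurable_funB.
  by under eq_fun do rewrite in_itv/=; apply: measurable_and;
    exact: measurable_fun_ler.
have -> : \int[U]_x f x - c = \int[U]_x g x.
  rewrite -[X in _ - X](Rintegral_probability_cst U) -RintegralB//.
  - apply: eq_Rintegral_uniform_prob => //; first exact: measurable_funB.
    by move=> x abx; rewrite /g abx.
  - exact: (bounded_integrable U mf fM).
  - exact: finite_measure_integrable_cst.
apply: normr_Rintegral_probability => // x.
by rewrite /g; case: ifPn => [/fc//|_]; rewrite normr0.
Qed.

End uniform_integral.

(** * Test functions that vary smoothly with the secret *)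

Section coalition.
Context {R : realType} (N t : nat) {d} {T : measurableType d}
  (P : probability T R) (n : 'I_t -> {RV P >-> R[i]}) (A : {set 'I_N}).

(** Only displacements caused by the secret at a fixed noise are controlled, with a constant uniform
    in the noise. This is what makes the conditional mean of [f] Lipschitz in [s]. *)
Definition lipschitz_in_secret : set (#|A|.-tuple R[i] -> R) :=
  [set f : #|A|.-tuple R[i] -> R | [/\ measurable_fun setT f, forall y, 0 <= f y <= 1 &
    exists K, forall w s s',
      `|f (observation_at n A s w) - f (observation_at n A s' w)| <= K * `|s - s'|]].

Lemma lipschitz_in_secret0 : lipschitz_in_secret (cst 0).
Proof.
split => //=; first by move=> _; rewrite lexx ler01.
by exists 0 => w s s'; rewrite subrr normr0 mul0r.
Qed.

Lemma lipschitz_in_secretC f :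
  lipschitz_in_secret f -> lipschitz_in_secret (fun y => 1 - f y).
Proof.
move=> [mf f01 [K fK]]; split; first exact: measurable_funB.
- by move=> y; have := f01 y; lra.
- exists K => w s s'; rewrite (_ : _ - _ = - (f (observation_at n A s w) -
      f (observation_at n A s' w))); last by ring.
  by rewrite normrN.
Qed.

Lemma lipschitz_in_secretM f g :
  lipschitz_in_secret f -> lipschitz_in_secret g ->
  lipschitz_in_secret (fun y => f y * g y).
Proof.
move=> [mf f01 [K fK]] [mg g01 [L gL]]; split; first exact: measurable_funM.
- move=> y; have /andP[f0 f1] := f01 y; have /andP[g0 g1] := g01 y.
  by rewrite mulr_ge0//= mulr_ile1.
- exists (K + L) => w s s'; move: (fK w s s') (gL w s s').
  set y := observation_at _ _ s w; set z := observation_at _ _ s' w => fyz gyz.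
  rewrite (_ : _ - _ = (f y - f z) * g y + f z * (g y - g z)); last by ring.
  rewrite (le_trans (ler_normD _ _))// !normrM mulrDl lerD//.
  + have /andP[g0 g1] := g01 y.
    by rewrite (le_trans _ fyz)// ler_piMr// ger0_norm.
  + have /andP[f0 f1] := f01 z.
    by rewrite (le_trans _ gyz)// ler_piMl// ger0_norm.
Qed.

Variable mu : probability (#|A|.-tuple R[i]) R.

(** The approximants are ramps in [u], rising linearly from 0 at [a] to 1 at [a + k.+1%:R^-1], hence
    Lipschitz with constant [k.+1%:R]. Such a ramp lies between the indicators of [F k] and of the
    whole preimage, so its error is at most their difference, which is small for large [k]. *)
Lemma L1_approximable_ray (u : #|A|.-tuple R[i] -> R) a :
  measurable_fun setT u ->
  (forall w s s', `|u (observation_at n A s w) - u (observation_at n A s' w)|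
    <= `|s - s'|) ->
  L1_approximable mu lipschitz_in_secret (u @^-1` `]a, +oo[).
Proof.
move=> mu_ uL.
pose F k := u @^-1` `]a + k.+1%:R^-1, +oo[.
have mF k : measurable (F k).
  by rewrite -[X in measurable X]setTI; exact: mu_.
have ndF : nondecreasing_seq F.
  move=> k l kl; apply/subsetPset => y; rewrite /F /= !in_itv/= !andbT.
  by apply: le_lt_trans; rewrite lerD2l lef_pV2 ?posrE// ler_nat.
have FE : \bigcup_k F k = u @^-1` `]a, +oo[.
  apply/seteqP; split => y /=.
    move=> [k _]; rewrite /F /= !in_itv/= !andbT; apply: lt_trans.
    by rewrite ltrDl invr_gt0.
  rewrite in_itv/= andbT => /ltr_add_invr[k ak]; exists k => //.
  by rewrite /F /= in_itv/= andbT.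
split; first by rewrite -FE; exact: bigcupT_measurable.
move=> e e0; have [k Fk] := nondecreasing_bigcup_approx mu mF ndF e0.
pose f y := Num.min 1 (Num.max 0 (k.+1%:R * (u y - a))).
have f01 y : 0 <= f y <= 1.
  by rewrite /f le_min ler01 le_max lexx/= ge_min lexx.
have mf : measurable_fun setT f.
  apply: measurable_minr => //; apply: measurable_maxr => //.
  by apply: measurable_funM => //; exact: measurable_funB.
have maxL (x y : R) : `|Num.max 0 x - Num.max 0 y| <= `|x - y|.
  have := ler_norm (x - y); have := ler_norm (y - x); rewrite (distrC y x) ler_norml.
  by case: (leP 0 x) => ?; case: (leP 0 y) => ?; lra.
have minL (x y : R) : `|Num.min 1 x - Num.min 1 y| <= `|x - y|.
  have := ler_norm (x - y); have := ler_norm (y - x); rewrite (distrC y x) ler_norml.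
  by case: (leP 1 x) => ?; case: (leP 1 y) => ?; lra.
exists f.
  split => //; exists k.+1%:R => w s s'; rewrite (le_trans (minL _ _))// (le_trans (maxL _ _))//.
  rewrite -mulrBr normrM ger0_norm// ler_wpM2l//.
  by rewrite opprB addrA subrK uL.
apply: le_trans Fk; apply: (@ler_Rintegral_probability _ _ _ _ 1).
- apply: measurableT_comp => //; apply: measurable_funB => //.
  by apply: measurable_indic; rewrite -FE; exact: bigcupT_measurable.
- by apply: measurable_funB; apply: measurable_indic => //; exact: bigcupT_measurable.
- move=> y; rewrite normr_id indicE ler_norml; have := f01 y.
  by case: (y \in _) => /=; lra.
- by move=> y; rewrite !indicE ler_norml; case: (_ \in _); case: (_ \in _) => /=; lra.
move=> y; rewrite FE !indicE.
have [/set_mem/=|/negP] := boolP (y \in _ @^-1` `]a, +oo[); last first.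
  rewrite inE /= in_itv/= andbT => /negP; rewrite -leNgt => uya.
  have -> : f y = 0.
    by rewrite /f max_l ?min_r// pmulr_rle0// subr_le0.
  rewrite subr0 normr0 memNset ?subr0// /F /= in_itv/= andbT => uy.
  by move: uy; rewrite ltNge (le_trans uya)// lerDl invr_ge0.
move=> _; have [/set_mem|_] := boolP (y \in F k).
  rewrite /F /= in_itv/= andbT -ltrBrDl => uy.
  have -> : f y = 1.
    rewrite /f min_l// le_max; apply/orP; right.
    by rewrite mulrC -ler_pdivrMr// mul1r ltW.
  by rewrite subrr normr0.
by have := f01 y; rewrite subr0 ler_norml; lra.
Qed.

(** The real and imaginary parts of the coordinates generate the sigma-algebra on tuples. The secret
    translates each real part by [s] and leaves each imaginary part fixed, so the ray lemma applies
    to both. *)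
Lemma measurable_L1_approximable E : measurable E ->
  L1_approximable mu lipschitz_in_secret E.
Proof.
set H := L1_approximable mu lipschitz_in_secret.
have sH : sigma_algebra setT H.
  apply: sigma_algebra_L1_approximable.
  - by move=> f [].
  - by move=> f y [].
  - exact: lipschitz_in_secret0.
  - exact: lipschitz_in_secretC.
  - exact: lipschitz_in_secretM.
have mray (u : #|A|.-tuple R[i] -> R) : (forall a, H (u @^-1` `]a, +oo[)) ->
    measurable_fun [set: g_sigma_algebraType H] u.
  move=> Hu; apply: (measurability _ (RGenOInfty.measurableE R)).
  move=> _ [_ [a ->] <-]; rewrite setTI; exact: sub_sigma_algebra.
(* Measurability of the identity says that every measurable set of tuples lies in the sigma-algebra
   generated by [H], which is [H] itself. *)
have mid : measurable_fun [set: g_sigma_algebraType H]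
    (id : g_sigma_algebraType H -> #|A|.-tuple R[i]).
  apply/measurable_fun_tnthP => i; apply/measurable_fun_complexP; split; apply: mray => a.
  - apply: L1_approximable_ray.
      exact: measurableT_comp measurable_Re (measurable_tnth i).
    move=> w s s' /=; rewrite !tnth_mktuple /share /=.
    set c := \sum_(j < t) _; case: c => c1 c2 /=.
    by rewrite opprD addrACA subrr addr0.
  - apply: L1_approximable_ray.
      exact: measurableT_comp measurable_Im (measurable_tnth i).
    move=> w s s' /=; rewrite !tnth_mktuple /share /=.
    set c := \sum_(j < t) _; case: c => c1 c2 /=.
    by rewrite subrr normr0.
move=> mE; have := mid measurableT _ mE; rewrite setTI preimage_id.
by rewrite -[X in _ -> X E](sigma_algebra_id sH).
Qed.

End coalition.

(** * Iterated integrals against a product probability *)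

Lemma Rintegral_product_probability {R : realType} d1 d2 (T1 : measurableType d1)
    (T2 : measurableType d2) (P1 : probability T1 R) (P2 : probability T2 R)
    (M : R) (f : T1 * T2 -> R) :
  measurable_fun setT f -> (forall z, `|f z| <= M) ->
  \int[(P1 \x P2)%E]_z f z = \int[P1]_x \int[P2]_y f (x, y).
Proof.
move=> mf fM; rewrite /Rintegral -integral12_prod_meas1; last first.
  exact: bounded_integrable fM.
congr fine; apply: eq_integral => x _; rewrite /fubini_F fineK//.
apply: integrable_fin_num => //; apply: bounded_integrable (fun=> fM _).
exact: measurableT_comp.
Qed.

(** * The bound for Lipschitz tests, by a prior concentrated near two secrets *)

Section smooth_tests.
Context {R : realType} (N t : nat) {d} {T : measurableType d}
  (P : probability T R) (n : 'I_t -> {RV P >-> R[i]}) (A : {set 'I_N}) (r : R).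
Hypothesis At : #|A| = t.

Lemma Rintegral_lipschitz_le_MIS (f : #|A|.-tuple R[i] -> R) (s1 s2 : R) :
  lipschitz_in_secret n f -> - r <= s1 -> s1 < s2 -> s2 <= r ->
  (`|\int[P]_w f (observation_at n A s1 w) -
     \int[P]_w f (observation_at n A s2 w)|%:E <= sqrte (2%:E * MIS N n r))%E.
Proof.
move=> [mf f01 [K0 fK0]] rs1 s12 s2r; pose F s := \int[P]_w f (observation_at n A s w).
rewrite -/(F s1) -/(F s2).
pose K := `|K0|.
have f1 y : `|f y| <= 1 by have /andP[f0 fle1] := f01 y; rewrite ger0_norm.
have mobs s : measurable_fun setT (fun w => f (observation_at n A s w)).
  by apply: (measurableT_comp mf); exact: measurable_observation_at.
have intf s : P.-integrable setT (EFin \o (fun w => f (observation_at n A s w))).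
  exact: bounded_integrable (fun=> f1 _).
have FK s s' : `|F s - F s'| <= K * `|s - s'|.
  rewrite /F -RintegralB//; [|exact: intf..].
  apply: normr_Rintegral_probability; first exact: measurable_funB.
  by move=> w; rewrite (le_trans (fK0 w s s'))// ler_wpM2r// ler_norm.
have F1 s : `|F s| <= 1 by exact: normr_Rintegral_probability.
have F01 s : 0 <= F s <= 1.
  rewrite Rintegral_ge0/=; last by move=> w _; have /andP[] := f01 (observation_at n A s w).
  exact: le_trans (ler_norm _) (F1 s).
have m2obs s : measurable_fun setT (fun w => 2 * f (observation_at n A s w)).
  exact: measurable_funM.
have f2obs s w : `|2 * f (observation_at n A s w)| <= 2.
  by have := f01 (observation_at n A s w); rewrite ler_norml; lra.
have mF : measurable_fun setT F.
  pose h (z : measurableTypeR R * T) := (f (observation n A z))%:E.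
  have mh : measurable_fun setT h.
    by apply/measurable_EFinP; apply: (measurableT_comp mf); exact: measurable_observation.
  have h0 z : (0 <= h z)%E by rewrite lee_fin; have /andP[] := f01 (observation n A z).
  rewrite (_ : F = fine \o fubini_F P h)//; apply: measurableT_comp => //.
  exact: measurable_fun_fubini_tonelli_F.
apply/lee_addgt0Pr => e e0.
(* The first bound puts the intervals [[s1 + dl, s1 + 2 * dl]] and [[s2 - 2 * dl, s2 - dl]] strictly
   on either side of the midpoint. The second makes [F] vary by at most [e / 2] between an interval
   and its end point [s1] or [s2]; [K + 1] keeps the denominator positive. *)
pose dl := Num.min ((s2 - s1) / 5) (e / (4 * (K + 1))).
have K_ge0 : 0 <= K by rewrite /K.
have dl_gt0 : 0 < dl.
  by rewrite /dl lt_min !divr_gt0 ?subr_gt0// mulr_gt0// ltr_wpDl.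
have dl_s : 5 * dl <= s2 - s1.
  by rewrite mulrC -ler_pdivlMr// /dl ge_min lexx.
have dl_e : K * (2 * dl) <= e / 2.
  have : dl <= e / (4 * (K + 1)) by rewrite /dl ge_min lexx orbT.
  rewrite ler_pdivlMr; last by rewrite mulr_gt0// ltr_wpDl.
  by nra.
have ab1 : s1 + dl < s1 + 2 * dl by lra.
have ab2 : s2 - 2 * dl < s2 - dl by lra.
pose U1 : probability (measurableTypeR R) R := uniform_prob ab1.
pose U2 : probability (measurableTypeR R) R := uniform_prob ab2.
pose Q : probability (measurableTypeR R) R := half_mixture U1 U2.
have QE E : Q E = ((2^-1)%:E * (U1 E + U2 E))%E by exact: half_mixtureE.
(* The density is the half-sum of the two uniform densities. Both intervals are moved inwards from
   [s1] and [s2] by at least [dl], so the strict bound [|s| < r] holds even when [s1] or [s2] is an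
   end point of the range. *)
have admQ : admissible_prior r Q.
  split.
    exists (fun x => 2^-1 * (uniform_pdf (s1 + dl) (s1 + 2 * dl) x +
                       uniform_pdf (s2 - 2 * dl) (s2 - dl) x)).
    have pdf0 x : 0 <= uniform_pdf (s1 + dl) (s1 + 2 * dl) x.
      exact: uniform_pdf_ge0.
    have pdf0' x : 0 <= uniform_pdf (s2 - 2 * dl) (s2 - dl) x.
      exact: uniform_pdf_ge0.
    split.
    - apply: measurable_funM => //.
      by apply: measurable_funD; exact: measurable_uniform_pdf.
    - by move=> x; rewrite mulr_ge0// addr_ge0.
    move=> E mE; rewrite QE /= /uniform_prob.
    under [RHS]eq_integral do rewrite EFinM EFinD.
    rewrite ge0_integralZl//; last 2 first.
    - apply: measurable_funTS; apply/measurable_EFinP.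
      by apply: measurable_funD; exact: measurable_uniform_pdf.
    - by move=> x _; rewrite -EFinD lee_fin addr_ge0.
    rewrite ge0_integralD//.
    - by move=> x _; rewrite lee_fin.
    - by apply: measurable_funTS; apply/measurable_EFinP; exact: measurable_uniform_pdf.
    - by move=> x _; rewrite lee_fin.
    - by apply: measurable_funTS; apply/measurable_EFinP; exact: measurable_uniform_pdf.
  rewrite QE /= /uniform_prob !integral_uniform_pdf1//.
  - by rewrite -EFinD -EFinM mulVf// -natrD pnatr_eq0.
  - by move=> x /=; rewrite in_itv/= ltr_norml; lra.
  - by move=> x /=; rewrite in_itv/= ltr_norml; lra.
(* Rescaling [f] to values in [-1, 1] brings a factor 2 that cancels the weight 1/2 of the mixture,
   and the constant -1 drops out because [phi] has mean zero. Hence the correlation of [phi] and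
   [psi] is exactly [D]. *)
pose phi (s : measurableTypeR R) : R := if s < (s1 + s2) / 2 then 1 else -1.
pose psi y := 2 * f y - 1.
have mphi : measurable_fun setT phi.
  by apply: measurable_fun_ifT => //; exact: measurable_fun_ltr.
have mpsi : measurable_fun setT psi.
  by apply: measurable_funB => //; exact: measurable_funM.
have phi1 s : `|phi s| <= 1 by rewrite /phi; case: ifP; rewrite ?normrN normr1.
have psi1 y : `|psi y| <= 1 by rewrite /psi ler_norml; have := f01 y; lra.
(* [phi] is 1 on the support of [U1] and -1 on that of [U2]. *)
have phiU (g : R -> R) : measurable_fun setT g -> (forall s, `|g s| <= 1) ->
    \int[Q]_s (phi s * g s) = (\int[U1]_s g s - \int[U2]_s g s) / 2.
  move=> mg g1; rewrite (@Rintegral_half_mixture _ _ _ _ _ 1); last 2 first.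
  - exact: measurable_funM.
  - by move=> s; rewrite normrM mulr_ile1.
  congr (_ / 2); congr (_ + _).
  - apply: eq_Rintegral_uniform_prob => //; first exact: measurable_funM.
    move=> s; rewrite in_itv/= /phi => /andP[s_ge s_le].
    by rewrite ifT ?mul1r//; lra.
  - rewrite -mulN1r -RintegralZl//; last exact: (bounded_integrable U2 mg g1).
    apply: eq_Rintegral_uniform_prob => //; try exact: measurable_funM.
    move=> s; rewrite in_itv/= /phi => /andP[s_ge s_le].
    by rewrite ifF//; apply/negbTE; rewrite -leNgt; lra.
pose D := \int[U1]_s F s - \int[U2]_s F s.
have intpsi s : P.-integrable setT (EFin \o (fun w => psi (observation_at n A s w))).
  apply: bounded_integrable (fun=> psi1 _).
  by apply: (measurableT_comp mpsi); exact: measurable_observation_at.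
have psiF s : \int[P]_w psi (observation_at n A s w) = 2 * F s - 1.
  rewrite RintegralB//; last 2 first.
  - exact: (bounded_integrable P (m2obs s) (f2obs s)).
  - exact: finite_measure_integrable_cst.
  by rewrite Rintegral_probability_cst RintegralZl//; exact: intf.
have boundD : (`|D|%:E <= sqrte (2%:E * MIS N n r))%E.
  have E0 : \int[secret_noise_prob P Q]_x phi (secret P Q x) = 0.
    rewrite (@Rintegral_product_probability _ _ _ _ _ Q P 1)//; last first.
      by apply: (measurableT_comp mphi); exact: measurable_fst.
    transitivity (\int[Q]_s (phi s * 1)).
      by apply: eq_Rintegral => s _; rewrite mulr1; exact: (Rintegral_probability_cst P (phi s)).
    rewrite (phiU (cst 1))//; last by move=> s; rewrite normr1.
    by rewrite !Rintegral_probability_cst subrr mul0r.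
  have ED : \int[secret_noise_prob P Q]_x
      (phi (secret P Q x) * psi (observationRV n Q A x)) = D.
    rewrite (@Rintegral_product_probability _ _ _ _ _ Q P 1); last 2 first.
    - apply: measurable_funM.
        by apply: (measurableT_comp mphi); exact: measurable_fst.
      by apply: (measurableT_comp mpsi); exact: measurable_observation.
    - by move=> z; rewrite normrM mulr_ile1.
    transitivity (\int[Q]_s (phi s * (2 * F s - 1))).
      apply: eq_Rintegral => s _; rewrite -psiF.
      exact: (RintegralZl (phi s) measurableT (intpsi s)).
    rewrite phiU; last 2 first.
    - by apply: measurable_funB => //; exact: measurable_funM.
    - move=> s; have := F01 s; rewrite ler_norml; lra.
    have UE (U : probability (measurableTypeR R) R) :
        \int[U]_s (2 * F s - 1) = 2 * \int[U]_s F s - 1.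
      rewrite RintegralB//; last 2 first.
      - apply: (@bounded_integrable _ _ _ _ 2); first exact: measurable_funM.
        by move=> s; have := F01 s; rewrite ler_norml; lra.
      - exact: finite_measure_integrable_cst.
      rewrite RintegralZl ?Rintegral_probability_cst//.
      exact: (bounded_integrable U mF F1).
    by rewrite !UE /D; lra.
  have := sqr_Rintegral_le_mutual_information (observationRV n Q A) mphi mpsi phi1 psi1 E0.
  rewrite ED => D2.
  have D2MIS : ((D ^+ 2)%:E <= 2%:E * MIS N n r)%E.
    apply: (le_trans D2); rewrite lee_pmul2l//; apply: ereal_sup_ubound.
    by exists A, Q.
  by rewrite -abse_EFin -sqrte_sqr -EFin_expe lee_sqrt// (le_trans _ D2MIS)// lee_fin sqr_ge0.
have h1 : `|\int[U1]_s F s - F s1| <= e / 2.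
  apply: (Rintegral_uniform_prob_dist ab1 mF F1); first by rewrite divr_ge0// ltW.
  move=> s; rewrite in_itv/= => /andP[s_ge s_le].
  rewrite (le_trans (FK _ _))// (le_trans _ dl_e)// ler_wpM2l// ger0_norm; lra.
have h2 : `|\int[U2]_s F s - F s2| <= e / 2.
  apply: (Rintegral_uniform_prob_dist ab2 mF F1); first by rewrite divr_ge0// ltW.
  move=> s; rewrite in_itv/= => /andP[s_ge s_le].
  rewrite (le_trans (FK _ _))// (le_trans _ dl_e)// ler_wpM2l// ler0_norm; lra.
apply: (@le_trans _ _ (`|D|%:E + e%:E)%E); last exact: leeD2r.
rewrite -EFinD lee_fin.
have -> : F s1 - F s2 = D - (\int[U1]_s F s - F s1) + (\int[U2]_s F s - F s2).
  by rewrite /D; ring.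
rewrite (le_trans (ler_normD _ _))// (splitr e) addrA lerD//.
by rewrite (le_trans (ler_normB _ _))// lerD2l.
Qed.

End smooth_tests.

(** * Total variation: from Lipschitz tests to arbitrary events *)

Theorem lemma3 (R : realType) (r sigma_n : R) (t N : nat)
    (d : measure_display) (T : measurableType d) (P : probability T R)
    (n : 'I_t -> {RV P >-> R[i]})
    (r_gt0 : 0 < r) (sigma_n_gt0 : 0 < sigma_n)
    (t_gt0 : (0 < t)%N) (t_ltN : (t < N)%N)
    (n_gauss : forall j, circular_gaussian (sigma_n ^+ 2 / t%:R) (n j))
    (n_indep : mutually_independent n) :
  (DS N n r <= sqrte (2%:E * MIS N n r))%E.
Proof.
apply: ge_ereal_sup => _ [A [s1 [s2 [At s1r s2r ->]]]].
apply: ge_ereal_sup => _ [E mE <-].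
apply/lee_addgt0Pr => e e0.
set P1 := observation_cond n A s1; set P2 := observation_cond n A s2.
(* Approximating under the half mixture gives one [f] for both conditional laws: an error of [e / 2]
   there means that the errors under [P1] and [P2] add up to at most [e]. *)
have [_ /(_ (e / 2))[|f Lf fE]] := measurable_L1_approximable n (half_mixture P1 P2) mE.
  by rewrite divr_gt0.
have [mf f01 _] := Lf.
have f1 y : `|f y| <= 1 by have /andP[f0 fle1] := f01 y; rewrite ger0_norm.
have mI : measurable_fun setT (\1_E : _ -> R) by exact: measurable_indic.
have err1 y : `|(f y - \1_E y : R)| <= 1.
  by have := f01 y; rewrite indicE ler_norml; case: (y \in E) => /=; lra.
have merr : measurable_fun setT (fun y => f y - \1_E y) by exact: measurable_funB.
have nerr1 y : `| `|(f y - \1_E y : R)| | <= 1 by rewrite normr_id.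
have mnerr : measurable_fun setT (fun y => `|f y - \1_E y|).
  exact: measurableT_comp.
move: fE; rewrite (Rintegral_half_mixture _ _ mnerr nerr1) => fE.
have errE (P' : probability (#|A|.-tuple R[i]) R) :
    `|\int[P']_y f y - fine (P' E)| <= \int[P']_y `|f y - \1_E y|.
  have -> : fine (P' E) = \int[P']_y \1_E y by rewrite /Rintegral integral_indic// setIT.
  rewrite -RintegralB//; last 2 first.
  - exact: bounded_integrable f1.
  - exact: integrable_indic.
  by apply: le_normr_Rintegral => //; exact: bounded_integrable err1.
have smooth : (`|\int[P1]_y f y - \int[P2]_y f y|%:E <= sqrte (2%:E * MIS N n r))%E.
  have condE s : \int[observation_cond n A s]_y f y =
      \int[P]_w f (observation_at n A s w).
    rewrite /Rintegral integral_distribution//; first exact/measurable_EFinP.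
    apply: bounded_integrable (fun=> f1 _).
    by apply: (measurableT_comp mf); exact: measurable_observation_at.
  rewrite !condE; have /andP[s1_ge s1_le] := s1r; have /andP[s2_ge s2_le] := s2r.
  have [s12|s21|->] := ltgtP s1 s2; last by rewrite subrr normr0 sqrte_ge0.
  - exact: Rintegral_lipschitz_le_MIS.
  - by rewrite distrC; exact: Rintegral_lipschitz_le_MIS.
apply: le_trans (leeD2r e%:E smooth).
rewrite -[P1 E]fineK ?fin_num_measure// -[P2 E]fineK ?fin_num_measure//.
rewrite -EFinB abse_EFin -EFinD lee_fin.
have := errE P1; have := errE P2; rewrite !ler_norml => /andP[a1 a2] /andP[b1 b2].
have := ler_norm (\int[P1]_y f y - \int[P2]_y f y).
have := ler_norm (- (\int[P1]_y f y - \int[P2]_y f y)); rewrite normrN.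
by move=> c1 c2; apply/andP; split; lra.
Qed.
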